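(* Let $\mathcal{X}$ be a finite nonempty set. All Hausdorff natural topologies on $\mathrm{DMC}_{\mathcal{X},\ast}^{(o)}$ have the same Borel $\sigma$-algebra: if $\mathcal{T}$ and $\mathcal{T}'$ are two Hausdorff natural topologies on $\mathrm{DMC}_{\mathcal{X},\ast}^{(o)}$, then the $\sigma$-algebra generated by $\mathcal{T}$ equals the $\sigma$-algebra generated by $\mathcal{T}'$.
   Context: For finite nonempty sets $\mathcal{X},\mathcal{Y}$, $\mathrm{DMC}_{\mathcal{X},\mathcal{Y}}$ is the set of channels from $\mathcal{X}$ to $\mathcal{Y}$, i.e. functions $W:\mathcal{X}\times\mathcal{Y}\to[0,1]$, written $W(y|x)$, with $\sum_{y\in\mathcal{Y}}W(y|x)=1$ for every $x\in\mathcal{X}$. It carries the topology inherited from the Euclidean topology of $\mathbb{R}^{\mathcal{X}\times\mathcal{Y}}$. For $W\in\mathrm{DMC}_{\mathcal{X},\mathcal{Y}}$ and $V\in\mathrm{DMC}_{\mathcal{Y},\mathcal{Z}}$, the composition $V\circ W\in\mathrm{DMC}_{\mathcal{X},\mathcal{Z}}$ is $(V\circ W)(z|x)=\sum_{y\in\mathcal{Y}}V(z|y)W(y|x)$. A channel $W'\in\mathrm{DMC}_{\mathcal{X},\mathcal{Z}}$ is degraded from $W\in\mathrm{DMC}_{\mathcal{X},\mathcal{Y}}$ if $W'=V\circ W$ for some $V\in\mathrm{DMC}_{\mathcal{Y},\mathcal{Z}}$; $W$ and $W'$ are equivalent if each is degraded from the other. $\mathrm{DMC}_{\mathcal{X},\mathcal{Y}}^{(o)}$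 is the quotient of $\mathrm{DMC}_{\mathcal{X},\mathcal{Y}}$ by this equivalence relation, with the quotient topology $\mathcal{T}_{\mathcal{X},\mathcal{Y}}^{(o)}$. Let $[n]=\{1,\dots,n\}$, let $\mathrm{DMC}_{\mathcal{X},\ast}=\coprod_{n\ge1}\mathrm{DMC}_{\mathcal{X},[n]}$, and let $\mathrm{DMC}_{\mathcal{X},\ast}^{(o)}$ be the quotient set of $\mathrm{DMC}_{\mathcal{X},\ast}$ by equivalence of channels. For each $n\geq 1$, $\mathrm{DMC}_{\mathcal{X},[n]}^{(o)}$ is identified with the subset of $\mathrm{DMC}_{\mathcal{X},\ast}^{(o)}$ consisting of the classes containing a channel with output alphabet $[n]$; these subsets increase with $n$ and their union is $\mathrm{DMC}_{\mathcal{X},\ast}^{(o)}$. A topology on $\mathrm{DMC}_{\mathcal{X},\ast}^{(o)}$ is called natural if for every $n\ge1$ the subspace topology it induces on $\mathrm{DMC}_{\mathcal{X},[n]}^{(o)}$ is $\mathcal{T}_{\mathcal{X},[n]}^{(o)}$. *)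

(* Defs.v *)
From HB Require Import structures.
From mathcomp Require Import all_boot all_order all_algebra.
From mathcomp Require Import all_classical all_reals all_analysis.
Set Implicit Arguments.
Unset Strict Implicit.
Unset Printing Implicit Defensive.
Import Order.TTheory GRing.Theory Num.Theory.
Import numFieldNormedType.Exports.
Local Open Scope classical_set_scope.
Local Open Scope ring_scope.
Local Open Scope quotient_scope.

(* The ambient function space carries the product topology, which is the
   Euclidean topology of R^(X * Y) since X * Y is finite; as a [set_type], a
   type of channels is then a topologicalType for the subspace topology. *)
Definition is_channel (R : realType) (X Y : finType) :
    set ({ptws X * Y -> R}) :=
  [set W | (forall x y, 0 <= W (x, y) <= 1) /\
           forall x, \sum_(y : Y) W (x, y) = 1].

Definition DMC (R : realType) (X Y : finType) := set_type (@is_channel R X Y).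
HB.instance Definition _ R X Y := Topological.on (@DMC R X Y).

Section Channels.
Context {R : realType}.

(* [chan W x y] is W(y|x). *)
Definition chan (X Y : finType) (W : DMC R X Y) (x : X) (y : Y) : R :=
  \val W (x, y).

Definition chan_comp_fun (X Y Z : finType) (V : DMC R Y Z) (W : DMC R X Y) :
    {ptws X * Z -> R} :=
  fun xz => \sum_(y : Y) chan V y xz.2 * chan W xz.1 y.

Lemma chan_comp_subproof (X Y Z : finType) (V : DMC R Y Z) (W : DMC R X Y) :
  chan_comp_fun V W \in @is_channel R X Z.
Proof.
have [V01 V1] := set_mem (valP V); have [W01 W1] := set_mem (valP W).
have sum1 x : \sum_z chan_comp_fun V W (x, z) = 1.
  rewrite exchange_big -[RHS](W1 x) /=; apply: eq_bigr => y _.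
  by rewrite -mulr_suml [X in X * _](V1 y) mul1r.
have ge0 x z : 0 <= chan_comp_fun V W (x, z).
  apply: sumr_ge0 => y _; apply: mulr_ge0.
    by have /andP[] := V01 y z.
  by have /andP[] := W01 x y.
rewrite inE; split=> // x z; rewrite ge0 /= -(sum1 x) (bigD1 z) //=.
by rewrite lerDl sumr_ge0.
Qed.

Definition chan_comp (X Y Z : finType) (V : DMC R Y Z) (W : DMC R X Y) :
  DMC R X Z := exist _ (chan_comp_fun V W) (chan_comp_subproof V W).

Definition degraded (X Y Z : finType) (W' : DMC R X Z) (W : DMC R X Y) : Prop :=
  exists V : DMC R Y Z, W' = chan_comp V W.

Definition chan_equiv (X Y Z : finType) (W : DMC R X Y) (W' : DMC R X Z) :
  Prop := degraded W' W /\ degraded W W'.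

Lemma chan_eqP (X Y : finType) (W W' : DMC R X Y) :
  (forall x y, chan W x y = chan W' x y) -> W = W'.
Proof. by move=> h; apply/val_inj/funext => -[x y]; exact: h. Qed.

Definition chan_id_fun (Y : finType) : {ptws Y * Y -> R} :=
  fun yz => (yz.1 == yz.2)%:R.

Lemma chan_id_subproof (Y : finType) : @chan_id_fun Y \in @is_channel R Y Y.
Proof.
rewrite inE; split=> [x y|x]; first by rewrite /chan_id_fun ler0n lern1 leq_b1.
rewrite (bigD1 x) //= big1 /chan_id_fun /= ?eqxx ?addr0 // => y.
by rewrite eq_sym => /negPf ->.
Qed.

Definition chan_id (Y : finType) : DMC R Y Y :=
  exist _ (@chan_id_fun Y) (chan_id_subproof Y).

Lemma degraded_refl (X Y : finType) (W : DMC R X Y) : degraded W W.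
Proof.
exists (chan_id Y); apply: chan_eqP => x z.
rewrite [RHS](bigD1 z) //= /chan /= /chan_id_fun /= eqxx mul1r big1 ?addr0 //.
by move=> y /negPf ->; rewrite mul0r.
Qed.

Lemma degraded_trans (X Y Z T : finType)
    (W : DMC R X Y) (W' : DMC R X Z) (W'' : DMC R X T) :
  degraded W' W -> degraded W'' W' -> degraded W'' W.
Proof.
move=> [V ->] [V' ->]; exists (chan_comp V' V); apply: chan_eqP => x t.
rewrite /chan /= /chan_comp_fun /chan /= /chan_comp_fun /=.
under eq_bigr do rewrite mulr_sumr.
rewrite exchange_big; apply: eq_bigr => y _.
by rewrite mulr_suml; apply: eq_bigr => z _; rewrite mulrA.
Qed.

Lemma chan_equiv_refl (X Y : finType) (W : DMC R X Y) : chan_equiv W W.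
Proof. by split; exact: degraded_refl. Qed.

Lemma chan_equiv_sym (X Y Z : finType) (W : DMC R X Y) (W' : DMC R X Z) :
  chan_equiv W W' -> chan_equiv W' W.
Proof. by case. Qed.

Lemma chan_equiv_trans (X Y Z T : finType)
    (W : DMC R X Y) (W' : DMC R X Z) (W'' : DMC R X T) :
  chan_equiv W W' -> chan_equiv W' W'' -> chan_equiv W W''.
Proof.
move=> [h1 h2] [h3 h4]; split; first exact: degraded_trans h1 h3.
exact: degraded_trans h4 h2.
Qed.

End Channels.

Section QuotientFixedOutput.
Variables (R : realType) (X Y : finType).

Definition chan_equivb : rel (DMC R X Y) := fun W W' => `[< chan_equiv W W' >].

Lemma chan_equivb_equiv : equiv_class_of chan_equivb.
Proof.
split=> [W|W W'|W' W W''].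
- exact/asboolP/chan_equiv_refl.
- by apply/asboolP/asboolP => /chan_equiv_sym.
- move=> /asboolP h1 /asboolP h2; apply/asboolP; exact: chan_equiv_trans h1 h2.
Qed.

Canonical chan_equivb_rel := EquivRelPack chan_equivb_equiv.

Definition DMCo := quotient_topology {eq_quot chan_equivb_rel}.
HB.instance Definition _ := Topological.on DMCo.
HB.instance Definition _ := Quotient.on DMCo.

End QuotientFixedOutput.

Section QuotientAnyOutput.
Variables (R : realType) (X : finType).

(* The alphabet [n] with n >= 1 is 'I_m.+1 with m = n - 1. *)
Definition DMCs := {m : nat & DMC R X 'I_m.+1}.
HB.instance Definition _ := Choice.on DMCs.

Definition chans_equivb : rel DMCs :=
  fun W W' => `[< chan_equiv (tagged W) (tagged W') >].

Lemma chans_equivb_equiv : equiv_class_of chans_equivb.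
Proof.
split=> [W|W W'|W' W W''].
- exact/asboolP/chan_equiv_refl.
- by apply/asboolP/asboolP => /chan_equiv_sym.
- move=> /asboolP h1 /asboolP h2; apply/asboolP; exact: chan_equiv_trans h1 h2.
Qed.

Canonical chans_equivb_rel := EquivRelPack chans_equivb_equiv.

Definition DMCso := {eq_quot chans_equivb_rel}.
HB.instance Definition _ := Choice.on DMCso.
HB.instance Definition _ := Quotient.on DMCso.

Definition DMCs_class (m : nat) (W : DMC R X 'I_m.+1) : DMCso :=
  \pi_DMCso (existT _ m W).

(* The identification of DMCo R X 'I_m.+1 with a subset of DMCso; the three
   lemmas below show that it sends the class of W to the class of W, that it is
   injective, and what its range is. *)
Definition DMCo_embed (m : nat) (c : DMCo R X 'I_m.+1) : DMCso :=
  DMCs_class (repr c).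

Lemma DMCo_embedE (m : nat) (W : DMC R X 'I_m.+1) :
  DMCo_embed (\pi_(DMCo R X 'I_m.+1) W) = DMCs_class W.
Proof.
apply/eqmodP/asboolP => /=.
have /eqmodP/asboolP : repr (\pi_(DMCo R X 'I_m.+1) W) = W
    %[mod {eq_quot @chan_equivb_rel R X 'I_m.+1}] by rewrite reprK.
by [].
Qed.

Lemma DMCo_embed_inj (m : nat) : injective (@DMCo_embed m).
Proof.
move=> c d /eqmodP/asboolP /= h; rewrite -[c]reprK -[d]reprK.
exact/eqmodP/asboolP.
Qed.

Lemma range_DMCo_embed (m : nat) :
  range (@DMCo_embed m) = [set c | exists W : DMC R X 'I_m.+1, c = DMCs_class W].
Proof.
apply/seteqP; split=> [_ [c _ <-]|_ [W ->]]; first by exists (repr c).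
by exists (\pi_(DMCo R X 'I_m.+1) W) => //; exact: DMCo_embedE.
Qed.

End QuotientAnyOutput.

(* A topology as a collection of open sets, so that several topologies on the
   same type can be compared. [topo_space O] is T with the topology O, which
   gives access to the library's notions ([open_topo_space]). *)
Record topology_on (T : Type) := TopologyOn {
  is_open : set (set T);
  is_openT : is_open setT;
  is_openI : forall A B, is_open A -> is_open B -> is_open (A `&` B);
  is_open_bigcup : forall F : set (set T),
    F `<=` is_open -> is_open (\bigcup_(A in F) A) }.

Definition topo_space (T : choiceType) (O : topology_on T) : Type := T.

Section TopoSpace.
Variables (T : choiceType) (O : topology_on T).

Lemma topo_space_bigcup (I : Type) (f : I -> set T) :
  (forall i, is_open O (f i)) -> is_open O (\bigcup_i f i).
Proof.
move=> Of; rewrite -(bigcup_image setT f id).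
by apply: is_open_bigcup => A [i _ <-].
Qed.

HB.instance Definition _ := Choice.copy (topo_space O) T.
HB.instance Definition _ := isOpenTopological.Build (topo_space O)
  (is_openT O) (@is_openI T O) topo_space_bigcup.

Lemma open_topo_space : @open (topo_space O) = is_open O.
Proof. by []. Qed.

End TopoSpace.

Definition subspace_opens (T : Type) (O : topology_on T) (S : set T) :
  set (set T) := [set U `&` S | U in is_open O].

Definition natural_topology (R : realType) (X : finType)
    (O : topology_on (DMCso R X)) : Prop :=
  forall m : nat,
    subspace_opens O (range (@DMCo_embed R X m)) =
    [set @DMCo_embed R X m @` A | A in @open (DMCo R X 'I_m.+1)].

Definition borel (T : Type) (O : topology_on T) : set (set T) :=
  <<s is_open O >>.

(* Main.v *)
(** The space of channels with output alphabet [n] is compact by Tychonoff, so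
    its quotient is compact, and in a Hausdorff natural topology the image of
    this quotient is closed. An open set U of one topology is the countable
    union of its traces on these images, and each trace is also the trace of an
    open set of the other topology: U is a countable union of sets that are the
    intersection of an open and a closed set of the other topology. *)

Require Import Defs.
From mathcomp Require Import all_boot all_order all_algebra.
From mathcomp Require Import all_classical all_reals all_analysis.

Import Order.TTheory GRing.Theory Num.Theory.
Import numFieldNormedType.Exports.
Local Open Scope classical_set_scope.
Local Open Scope ring_scope.
Local Open Scope quotient_scope.

(** A proper filter on [S] pushes forward to one on [range f], which clusters at some [f s].
    Neighbourhoods of [s] contain preimages of open sets around [f s], so the original filter
    clusters at [s]. This transfers compactness from a subset to its [set_type]. *)
Lemma compact_initial_topology (S : choiceType) (T : topologicalType)
    (f : S -> T) :
  compact (range f) -> compact [set: initial_topology f].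
Proof.
move=> cf F PF FT.
have [_ [[s _ <-] cls]] : range f `&` cluster (f x @[x --> F]) !=set0.
  apply: cf; rewrite fmapE; suff -> : f @^-1` range f = setT by [].
  by apply/seteqP; split=> // x _; exists x.
exists s; split=> // A B FA [_ [[W oW <-] Wfs] WB].
have [_ [[x Ax <-] Wfx]] : f @` A `&` W !=set0.
  apply: cls; last exact: open_nbhs_nbhs.
  by rewrite fmapE; apply: filterS FA => x Ax; exists x.
by exists x; split=> //; exact: WB.
Qed.

Lemma closed_is_channel (R : realType) (X Y : finType) :
  closed (@is_channel R X Y).
Proof.
have proj_cts (i : X * Y) : continuous (fun W : {ptws X * Y -> R} => W i).
  exact: (@proj_continuous _ (fun _ : X * Y => R) i).
(* Each constraint is a closed condition on one coordinate or on a finite sum of coordinates. *)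
have -> : @is_channel R X Y =
    \bigcap_i ((fun W : {ptws X * Y -> R} => W i) @^-1` `[0, 1]) `&`
    \bigcap_x ((fun W : {ptws X * Y -> R} => \sum_(y : Y) W (x, y))
      @^-1` [set 1]).
  apply/seteqP; split=> W /=.
    case=> W01 W1; split=> [[x y] _|x _]; last exact: W1.
    by rewrite /= in_itv; exact: W01.
  case=> W01 W1; split=> [x y|x]; last exact: W1.
  by have := W01 (x, y) I; rewrite /= in_itv.
apply: closedI; apply: closed_bigI => i _; apply: preimage_closed.
- by move=> W _; exact: proj_cts.
- exact: interval_closed.
- by move=> W _; apply: continuous_big => //; exact: add_continuous.
- exact: closed_eq.
Qed.

Lemma compact_is_channel (R : realType) (X Y : finType) :
  compact (@is_channel R X Y).
Proof.
have := @tychonoff _ (fun _ : X * Y => R) (fun=> `[0, 1]%classic)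
  (fun=> @segment_compact R 0 1).
move/(subclosed_compact (closed_is_channel R X Y)); apply.
by move=> W [W01 _] [x y] /=; rewrite in_itv; exact: W01.
Qed.

Lemma compact_DMC (R : realType) (X Y : finType) : compact [set: DMC R X Y].
Proof.
apply: compact_initial_topology.
rewrite (_ : range _ = @is_channel R X Y); first exact: compact_is_channel.
apply/seteqP; split=> [_ [W _ <-]|W cW]; first exact: set_mem (valP W).
by exists (exist _ W (mem_set cW)).
Qed.

Lemma compact_DMCo (R : realType) (X Y : finType) : compact [set: DMCo R X Y].
Proof.
rewrite (_ : setT = \pi_(DMCo R X Y) @` setT).
  apply: continuous_compact (@compact_DMC R X Y).
  by apply: continuous_subspaceT => W; exact: pi_continuous.
by apply/seteqP; split=> // c _; exists (repr c) => //; exact: reprK.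
Qed.

Section NaturalTopology.
Variables (R : realType) (X : finType) (O : topology_on (DMCso R X)).
Hypothesis natO : natural_topology O.

(** Naturality makes the trace of an open [U] on the range the image of an open [A]; injectivity of
    [DMCo_embed] then forces the preimage of [U] to be [A]. *)
Lemma natural_DMCo_embed_continuous (m : nat) :
  continuous (@DMCo_embed R X m : DMCo R X 'I_m.+1 -> topo_space O).
Proof.
apply/continuousP => U oU.
have [A oA AE] : [set @DMCo_embed R X m @` A | A in open]
    (U `&` range (@DMCo_embed R X m)).
  by rewrite -natO; exists U.
rewrite (_ : _ @^-1` U = A)//; apply/seteqP; split=> c /=.
- move=> Uc; have : (U `&` range (@DMCo_embed R X m)) (DMCo_embed c) by [].
  by rewrite -AE => -[d Ad /DMCo_embed_inj <-].
- move=> Ac; have : (@DMCo_embed R X m @` A) (DMCo_embed c) by exists c.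
  by rewrite AE => -[].
Qed.

Lemma natural_range_DMCo_embed_closed (m : nat) :
  hausdorff_space (topo_space O) ->
  is_open O (~` range (@DMCo_embed R X m)).
Proof.
move=> hO.
have : closed (range (@DMCo_embed R X m) : set (topo_space O)).
  apply: (compact_closed hO).
  apply: continuous_compact (@compact_DMCo R X 'I_m.+1).
  by apply: continuous_subspaceT; exact: natural_DMCo_embed_continuous.
by move=> /closed_openC.
Qed.

End NaturalTopology.

Lemma bigcup_range_DMCo_embed (R : realType) (X : finType) :
  \bigcup_m range (@DMCo_embed R X m) = [set: DMCso R X].
Proof.
apply/seteqP; split=> // c _; case cE : (repr c) => [m W].
exists m => //; rewrite range_DMCo_embed; exists W.
by rewrite /DMCs_class -cE reprK.
Qed.

(** Only one inclusion is proved, under one-sided hypotheses; equality follows by exchanging [O] and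
    [O']. *)
Lemma borel_sub_cover (T : Type) (O O' : topology_on T) (S : (set T)^nat) :
  \bigcup_m S m = setT -> (forall m, is_open O' (~` S m)) ->
  (forall m, subspace_opens O (S m) `<=` subspace_opens O' (S m)) ->
  borel O `<=` borel O'.
Proof.
move=> ST clS OO'; apply: smallest_sub; first exact: smallest_sigma_algebra.
move=> U oU; rewrite -[U]setIT -ST setI_bigcupr.
apply: sigma_algebra_bigcup => m.
have [V oV <-] := OO' m _ (ex_intro2 _ _ U oU erefl).
(* De Morgan reduces the intersection to complements and a countable union, with [bigcup2] padding
   by empty sets. *)
rewrite (_ : V `&` S m = [set: T] `\` (~` V `|` ~` S m)); last first.
  by rewrite setTD setCU !setCK.
apply: sigma_algebraCD; rewrite -bigcup2E; apply: sigma_algebra_bigcup.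
case=> [|[|k]] /=.
- by rewrite -setTD; apply: sigma_algebraCD; exact: sub_sigma_algebra.
- by apply: sub_sigma_algebra; exact: clS.
- exact: sigma_algebra0.
Qed.

Theorem mainTheorem15 (R : realType) (X : finType) (X_neq0 : (0 < #|X|)%N)
  (O O' : topology_on (DMCso R X)) :
  hausdorff_space (topo_space O) -> natural_topology O ->
  hausdorff_space (topo_space O') -> natural_topology O' ->
  borel O = borel O'.
Proof.
move=> hO nO hO' nO'; apply/seteqP.
have cover := @bigcup_range_DMCo_embed R X.
split; apply: (borel_sub_cover _ _ _ _ cover) => m.
- exact: natural_range_DMCo_embed_closed.
(* Both families of traces are the images of the open sets of the same quotient [DMCo]. *)
- by rewrite nO nO'.
- exact: natural_range_DMCo_embed_closed.
- by rewrite nO nO'.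
Qed.
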